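(* Let $\mathcal{A}$ be a unital $C^*$-algebra and let $a\in\mathcal{A}$. Then the following assertions are equivalent: (i) $a$ is weak$^+$-Fredholm; (ii) $a$ is semi$^+$-Fredholm; (iii) the left $\mathcal{A}$-module $\mathcal{A}/\mathcal{A}a$ is semisimple; (iv) $\varrho_l(a)<\infty$ and $\mathcal{A}a$ is (norm-)closed in $\mathcal{A}$.
   Context: $C^*$-algebras are over $\mathbb{C}$. The socle $\mathrm{soc}(\mathcal{A})$ is the sum of all minimal left ideals of $\mathcal{A}$ (equivalently, since $\mathcal{A}$ is semiprime, of all minimal right ideals; it is $0$ if there are none); it is a two-sided ideal. ''Ideal'', ''module'' and ''length'' are meant purely algebraically (one-sided ideals need not be closed; $\mathcal{A}$ is viewed as a ring), and lengths take values in $\mathbb{N}_0\cup\{\infty\}$. For $a\in\mathcal{A}$: $a$ is weak$^+$-Fredholm if the left $\mathcal{A}$-module $\mathcal{A}/\mathcal{A}a$ has finite length; $a$ is semi$^+$-Fredholm if its image $[a]$ in the quotient ring $\mathcal{A}/\mathrm{soc}(\mathcal{A})$ is left invertible. $\varrho_l(a)$ is the length of the right ideal $\{x\in\mathcal{A}: yx=0 \text{ for all } y\in\mathcal{A}a\}$ as a right $\mathcal{A}$-module. *)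

(* Defs.v *)
From HB Require Import structures.
From mathcomp Require Import all_boot all_order all_algebra.
From mathcomp Require Import generic_quotient ring_quotient complex.
From mathcomp Require Import all_classical all_reals all_analysis.

Set Implicit Arguments.
Unset Strict Implicit.
Unset Printing Implicit Defensive.

Import Order.TTheory GRing.Theory Num.Theory.
Import numFieldNormedType.Exports.

Local Open Scope classical_set_scope.
Local Open Scope ring_scope.
Local Open Scope quotient_scope.

(* [NumDomain] is a join of rings and normed Z-modules, so no other hierarchy
   structure can extend both.  A C*-algebra is therefore a complete normed
   R[i]-module with product and involution, and its ring structure is declared
   afterwards on the carrier.  1 = 0 is not excluded.  Norms are elements of
   R[i], as for every [normedModType R[i]]. *)
HB.mixin Record isCStarAlgebra (R : realType) A
    of CompleteNormedModule R[i] A := {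
  cstar_one : A;
  cstar_mul : A -> A -> A;
  star : A -> A;
  cstar_mulA : associative cstar_mul;
  cstar_mul1r : left_id cstar_one cstar_mul;
  cstar_mulr1 : right_id cstar_one cstar_mul;
  cstar_mulDl : left_distributive cstar_mul +%R;
  cstar_mulDr : right_distributive cstar_mul +%R;
  cstar_scalerAl : forall (k : R[i]) (x y : A),
    k *: cstar_mul x y = cstar_mul (k *: x) y;
  cstar_scalerAr : forall (k : R[i]) (x y : A),
    k *: cstar_mul x y = cstar_mul x (k *: y);
  cstar_normM : forall x y : A, `|cstar_mul x y| <= `|x| * `|y|;
  starK : involutive star;
  starD : {morph star : x y / x + y};
  starZ : forall (k : R[i]) (x : A), star (k *: x) = conjc k *: star x;
  starM : forall x y : A, star (cstar_mul x y) = cstar_mul (star y) (star x);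
  cstar_normE : forall x : A, `|cstar_mul (star x) x| = `|x| ^+ 2
}.

#[short(type="cstarAlgType")]
HB.structure Definition CStarAlgebra (R : realType) :=
  {A of CompleteNormedModule R[i] A & isCStarAlgebra R A}.

HB.instance Definition _ (R : realType) (A : cstarAlgType R) :=
  GRing.Zmodule_isPzRing.Build (CStarAlgebra.sort A)
    (@cstar_mulA R A) (@cstar_mul1r R A) (@cstar_mulr1 R A)
    (@cstar_mulDl R A) (@cstar_mulDr R A).

(* Modules are left modules and submodules are elements of [submodClosed M].
   The left regular module of a ring A is A^o, so left ideals are elements of
   [submodClosed A^o].  Right A-modules are left modules over the converse ring
   A^c; the right regular module is (A^c)^o, where a *: x is the product x * a
   of A, so right ideals are elements of [submodClosed (A^c)^o]. *)

Section Modules.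
Variables (A : pzRingType) (M : lmodType A).
Implicit Types N P : submodClosed M.

Definition full_pred : {pred M} := xpredT.

Lemma full_pred_submod : GRing.subsemimod_closed full_pred.
Proof. by []. Qed.

HB.instance Definition _ :=
  GRing.isSubmodClosed.Build A M full_pred full_pred_submod.

Definition full_submod : submodClosed M := full_pred.

Definition submod_lt N P :=
  {subset N <= P} /\ exists2 x, x \in P & x \notin N.

(* The submodules of N are the submodules of M contained in N. *)
Definition submod_chain N (n : nat) (c : nat -> submodClosed M) :=
  (forall i, (i <= n)%N -> {subset c i <= N}) /\
  (forall i, (i < n)%N -> submod_lt (c i) (c i.+1)).

Definition submod_length (R : realType) N : \bar R :=
  ereal_sup [set n%:R%:E | n in [set n | exists c, submod_chain N n c]].

Definition simple_submod N :=
  (exists2 x, x \in N & x != 0) /\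
  forall P, {subset P <= N} -> (forall x, x \in P -> x = 0) \/ {subset N <= P}.

(* Sum of all simple submodules: the finite sums of elements of these. *)
Definition socle_pred : {pred M} := fun x =>
  `[< exists2 s : seq M,
        (forall y, y \in s -> exists2 N, simple_submod N & y \in N) &
        x = \sum_(y <- s) y >].

Lemma socle_pred_submod : GRing.subsemimod_closed socle_pred.
Proof.
split; first split.
- by apply/asboolP; exists [::]; rewrite ?big_nil.
- move=> _ _ /asboolP[s sN ->] /asboolP[t tN ->]; apply/asboolP.
  exists (s ++ t); rewrite ?big_cat // => y.
  by rewrite mem_cat => /orP[/sN|/tN].
- move=> a _ /asboolP[s sN ->]; apply/asboolP.
  exists [seq a *: y | y <- s]; last by rewrite big_map scaler_sumr.
  by move=> _ /mapP[y /sN[N Ns yN] ->]; exists N => //; apply: rpredZ.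
Qed.

HB.instance Definition _ :=
  GRing.isSubmodClosed.Build A M socle_pred socle_pred_submod.

Definition socle : submodClosed M := socle_pred.

End Modules.

Definition mod_length (R : realType) (A : pzRingType) (M : lmodType A) :
  \bar R := submod_length R (full_submod M).

Definition semisimple (A : pzRingType) (M : lmodType A) :=
  forall x : M, x \in socle M.

Section QuotientModule.
Variables (A : pzRingType) (M : lmodType A) (N : submodClosed M).

Lemma submod_zmod_closed : GRing.zmod_closed (N : {pred M}).
Proof.
split=> [|x y xN yN]; first exact: rpred0.
by rewrite -scaleN1r rpredD // rpredZ.
Qed.

Definition submod_zmod : zmodClosed M :=
  HB.pack (N : {pred M})
    (GRing.isZmodClosed.Build M (N : {pred M}) submod_zmod_closed).

Definition quot_mod : Type := Quotient.quot submod_zmod.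

HB.instance Definition _ := GRing.Zmodule.on quot_mod.

Definition to_quot_mod (x : M) : quot_mod := \pi_(Quotient.quot submod_zmod) x.

Lemma to_quot_modK (u : quot_mod) :
  to_quot_mod (repr (u : Quotient.quot submod_zmod)) = u.
Proof. exact: reprK. Qed.

Lemma to_quot_modP (x y : M) :
  reflect (to_quot_mod x = to_quot_mod y) (x - y \in N).
Proof.
by rewrite -[x - y \in N]/(x - y \in submod_zmod) Quotient.idealrBE; apply: eqP.
Qed.

Lemma to_quot_modD : {morph to_quot_mod : x y / x + y}.
Proof. by move=> x y; rewrite /to_quot_mod raddfD. Qed.

Definition quot_mod_scale (a : A) (u : quot_mod) : quot_mod :=
  to_quot_mod (a *: repr (u : Quotient.quot submod_zmod)).

Lemma to_quot_modZ a x :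
  quot_mod_scale a (to_quot_mod x) = to_quot_mod (a *: x).
Proof.
apply/to_quot_modP; rewrite -scalerBr rpredZ //.
by apply/to_quot_modP; rewrite to_quot_modK.
Qed.

Lemma quot_mod_scalerA a b u :
  quot_mod_scale a (quot_mod_scale b u) = quot_mod_scale (a * b) u.
Proof. by rewrite -(to_quot_modK u) !to_quot_modZ scalerA. Qed.

Lemma quot_mod_scale1r : left_id 1 quot_mod_scale.
Proof. by move=> u; rewrite -(to_quot_modK u) to_quot_modZ scale1r. Qed.

Lemma quot_mod_scalerDr : right_distributive quot_mod_scale +%R.
Proof.
move=> a u v; rewrite -(to_quot_modK u) -(to_quot_modK v).
by rewrite -to_quot_modD !to_quot_modZ scalerDr to_quot_modD.
Qed.

Lemma quot_mod_scalerDl u :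
  {morph quot_mod_scale^~ u : a b / a + b}.
Proof.
move=> a b; rewrite -(to_quot_modK u).
by rewrite !to_quot_modZ scalerDl to_quot_modD.
Qed.

HB.instance Definition _ := GRing.Zmodule_isLmodule.Build A quot_mod
  quot_mod_scalerA quot_mod_scale1r quot_mod_scalerDr quot_mod_scalerDl.

End QuotientModule.

Definition ideal2_closed (A : pzRingType) (I : {pred A}) :=
  forall a x, x \in I -> a * x \in I /\ x * a \in I.

HB.mixin Record isTwoSidedIdeal (A : pzRingType) (I : A -> bool) := {
  ideal2_closed_subproof : ideal2_closed I
}.

#[short(type="twoSidedIdeal")]
HB.structure Definition TwoSidedIdeal (A : pzRingType) :=
  {I of GRing.ZmodClosed A I & isTwoSidedIdeal A I}.

(* The quotient rings of [ring_quotient] are restricted to proper ideals of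
   commutative rings. *)
Section QuotientRing.
Variables (A : pzRingType) (I : twoSidedIdeal A).

Definition quot_ring : Type := Quotient.quot I.

HB.instance Definition _ := GRing.Zmodule.on quot_ring.

Definition to_quot_ring (x : A) : quot_ring := \pi_(Quotient.quot I) x.

Lemma to_quot_ringK (u : quot_ring) :
  to_quot_ring (repr (u : Quotient.quot I)) = u.
Proof. exact: reprK. Qed.

Lemma to_quot_ringP (x y : A) :
  reflect (to_quot_ring x = to_quot_ring y) (x - y \in I).
Proof. by rewrite Quotient.idealrBE; apply: eqP. Qed.

Lemma to_quot_ringD : {morph to_quot_ring : x y / x + y}.
Proof. by move=> x y; rewrite /to_quot_ring raddfD. Qed.

Definition quot_ring_one : quot_ring := to_quot_ring 1.

Definition quot_ring_mul (u v : quot_ring) : quot_ring :=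
  to_quot_ring
    (repr (u : Quotient.quot I) * repr (v : Quotient.quot I)).

Lemma to_quot_ringM x y :
  quot_ring_mul (to_quot_ring x) (to_quot_ring y) = to_quot_ring (x * y).
Proof.
rewrite /quot_ring_mul; set x' := repr _; set y' := repr _.
have xI : x' - x \in I by apply/to_quot_ringP; rewrite to_quot_ringK.
have yI : y' - y \in I by apply/to_quot_ringP; rewrite to_quot_ringK.
have {xI} [_ xI] := @ideal2_closed_subproof A I y' _ xI.
have {yI} [yI _] := @ideal2_closed_subproof A I x _ yI.
apply/to_quot_ringP.
have -> : x' * y' - x * y = (x' - x) * y' + x * (y' - y).
  by rewrite mulrBl mulrBr subrKA.
exact: rpredD.
Qed.

Lemma quot_ring_mulA : associative quot_ring_mul.
Proof.
move=> u v w.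
rewrite -(to_quot_ringK u) -(to_quot_ringK v) -(to_quot_ringK w).
by rewrite !to_quot_ringM mulrA.
Qed.

Lemma quot_ring_mul1r : left_id quot_ring_one quot_ring_mul.
Proof. by move=> u; rewrite -(to_quot_ringK u) to_quot_ringM mul1r. Qed.

Lemma quot_ring_mulr1 : right_id quot_ring_one quot_ring_mul.
Proof. by move=> u; rewrite -(to_quot_ringK u) to_quot_ringM mulr1. Qed.

Lemma quot_ring_mulDl : left_distributive quot_ring_mul +%R.
Proof.
move=> u v w.
rewrite -(to_quot_ringK u) -(to_quot_ringK v) -(to_quot_ringK w).
by rewrite -to_quot_ringD !to_quot_ringM mulrDl to_quot_ringD.
Qed.

Lemma quot_ring_mulDr : right_distributive quot_ring_mul +%R.
Proof.
move=> u v w.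
rewrite -(to_quot_ringK u) -(to_quot_ringK v) -(to_quot_ringK w).
by rewrite -to_quot_ringD !to_quot_ringM mulrDr to_quot_ringD.
Qed.

HB.instance Definition _ := GRing.Zmodule_isPzRing.Build quot_ring
  quot_ring_mulA quot_ring_mul1r quot_ring_mulr1
  quot_ring_mulDl quot_ring_mulDr.

End QuotientRing.

Section SocleEndomorphism.
Variables (A : pzRingType) (M : lmodType A) (f : M -> M).
Hypotheses (fD : {morph f : x y / x + y}) (fZ : scalable f).

Let f0 : f 0 = 0.
Proof. by have := fZ 0 0; rewrite !scale0r. Qed.

Let image_pred (N : submodClosed M) : {pred M} :=
  fun x => `[< exists2 y, y \in N & x = f y >].

Let image_pred_submod N : GRing.subsemimod_closed (image_pred N).
Proof.
split; first split.
- by apply/asboolP; exists 0; rewrite ?rpred0.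
- move=> _ _ /asboolP[y yN ->] /asboolP[z zN ->]; apply/asboolP.
  by exists (y + z); [exact: rpredD|rewrite fD].
- move=> a _ /asboolP[y yN ->]; apply/asboolP.
  by exists (a *: y); [exact: rpredZ|rewrite fZ].
Qed.

Let preim_pred (P : submodClosed M) (N : submodClosed M) : {pred M} :=
  fun x => (x \in N) && (f x \in P).

Let preim_pred_submod P N : GRing.subsemimod_closed (preim_pred P N).
Proof.
split; first split.
- by rewrite unfold_in f0 !rpred0.
- move=> x y /andP[xN xP] /andP[yN yP].
  by rewrite unfold_in fD !rpredD.
- by move=> a x /andP[xN xP]; rewrite unfold_in fZ !rpredZ.
Qed.

Lemma socle_endo x : x \in socle M -> f x \in socle M.
Proof.
case/asboolP=> s sN ->; rewrite (big_morph f fD f0) big_seq.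
apply: rpred_sum => y /sN[N [_ Nmin] yN].
have [->|fy0] := eqVneq (f y) 0; first exact: rpred0.
pose FN : submodClosed M := HB.pack (image_pred N : M -> bool)
  (GRing.isSubmodClosed.Build A M (image_pred N : M -> bool)
    (@image_pred_submod N)).
have fyN : f y \in FN by apply/asboolP; exists y.
apply/asboolP; exists [:: f y]; last by rewrite big_seq1.
move=> z; rewrite inE => /eqP->; exists FN => //.
split=> [|P PFN]; first by exists (f y).
pose Q : submodClosed M := HB.pack (preim_pred P N : M -> bool)
  (GRing.isSubmodClosed.Build A M (preim_pred P N : M -> bool)
    (@preim_pred_submod P N)).
have QN : {subset Q <= N} by move=> u /andP[].
have [Q0|NQ] := Nmin Q QN.
- left=> u uP; have /asboolP[v vN uE] := PFN u uP.
  by rewrite uE (Q0 v) // unfold_in /= /preim_pred vN -uE.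
- by right=> u /asboolP[v /NQ/andP[_ vP] ->].
Qed.

End SocleEndomorphism.

Section Rings.
Variable A : pzRingType.
Implicit Type a : A.

Definition soc_pred : {pred A} := fun x => x \in socle A^o.

Lemma soc_pred_zmod : GRing.zmod_closed soc_pred.
Proof. exact: (submod_zmod_closed (socle A^o)). Qed.

Lemma soc_pred_ideal2 : ideal2_closed soc_pred.
Proof.
move=> a x xS; have {}xS : (x : A^o) \in socle A^o by [].
split.
  have: (a *: (x : A^o)) \in socle A^o by apply: rpredZ.
  by [].
apply: (@socle_endo A A^o (fun y => (y : A) * a)) xS => [y z|b y].
  exact: mulrDl.
exact: esym (mulrA _ _ _).
Qed.

HB.instance Definition _ := GRing.isZmodClosed.Build A soc_pred soc_pred_zmod.
HB.instance Definition _ := isTwoSidedIdeal.Build A soc_pred soc_pred_ideal2.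

Definition soc : twoSidedIdeal A := soc_pred.

(* The left ideal A a. *)
Definition lprincipal_pred a : {pred A^o} := fun x =>
  `[< exists b : A, x = b * a >].

Lemma lprincipal_pred_submod a : GRing.subsemimod_closed (lprincipal_pred a).
Proof.
split; first split.
- by apply/asboolP; exists 0; rewrite mul0r.
- move=> _ _ /asboolP[b ->] /asboolP[c ->]; apply/asboolP.
  by exists (b + c); rewrite mulrDl.
- by move=> b _ /asboolP[c ->]; apply/asboolP; exists (b * c); rewrite -mulrA.
Qed.

HB.instance Definition _ a := GRing.isSubmodClosed.Build A A^o
  (lprincipal_pred a) (lprincipal_pred_submod a).

Definition lprincipal a : submodClosed A^o := lprincipal_pred a.

Definition rann_pred (L : submodClosed A^o) : {pred (A^c)^o} := fun x =>
  `[< forall y : A, y \in L -> y * (x : A) = 0 >].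

Lemma rann_pred_submod L : GRing.subsemimod_closed (rann_pred L).
Proof.
split; first split.
- by apply/asboolP => y _; rewrite mulr0.
- move=> x z /asboolP xL /asboolP zL; apply/asboolP => y yL.
  by rewrite mulrDr xL // zL // addr0.
- move=> b x /asboolP xL; apply/asboolP => y yL.
  by rewrite -[b *: x]/((x : A) * (b : A)) mulrA xL // mul0r.
Qed.

HB.instance Definition _ L := GRing.isSubmodClosed.Build A^c (A^c)^o
  (rann_pred L) (rann_pred_submod L).

(* The right annihilator of L, as a right ideal. *)
Definition rann L : submodClosed (A^c)^o := rann_pred L.

Definition weakp_fredholm (R : realType) a :=
  (mod_length R (quot_mod (lprincipal a)) < +oo)%E.

Definition semip_fredholm a :=
  exists u : quot_ring soc, u * to_quot_ring soc a = 1.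

Definition rho_l (R : realType) a : \bar R :=
  submod_length R (rann (lprincipal a)).

End Rings.

(* Main.v *)
(** Both finite length of [A / A a] and closedness of [A a] force [A a = A e]
    for a projection [e]; then [A / A a] is isomorphic to [A (1 - e)], the
    involution exchanges [A (1 - e)] with the right annihilator [(1 - e) A] of
    [a], and left ideals of finite length lie in the socle by Brauer's lemma.

    The projection comes from a factorization of Cohen type: every [a] is
    [d v^2] with [v] selfadjoint in the closure of [A a].  The element [v] is a
    product of rational functions of [h = a^* a] which are close to 1 away from
    0 and small near 0, so only resolvents of selfadjoint elements are needed,
    no spectral theorem.  If [A a] is closed, then [v] is in [A a], hence in
    [A v^2], and [v = b v^2] makes [e = b v] a projection with [A v = A e].  If
    [A / A a] has finite length, iterate: the ascending chain of the left ideals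
    [A v_n], with [v_n] in [A v_(n+1)^2], stabilises, so that
    [v_(n+1) = b v_(n+1)^2] for some [n].  Then [e] lies in the closure of
    [A a], and a Neumann series shows that it lies in [A a]. *)

From HB Require Import structures.
Require Import Defs.
From mathcomp Require Import all_boot all_order all_algebra.
From mathcomp Require Import generic_quotient complex.
From mathcomp Require Import all_classical all_reals all_analysis.
From mathcomp Require Import ring lra.

Set Implicit Arguments.
Unset Strict Implicit.
Unset Printing Implicit Defensive.

Import Order.TTheory GRing.Theory Num.Theory.
Import numFieldNormedType.Exports.

Local Open Scope classical_set_scope.
Local Open Scope ring_scope.

(** * Chains of submodules *)

Section Submodules.
Variables (A : pzRingType) (M : lmodType A).
Implicit Types (N P Q S : submodClosed M) (T : M -> Prop).

(** Submodules are boolean predicates with a packed structure; through this lemma the ones needed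
    below are introduced by a propositional description of their elements. *)
Lemma submod_ofP T : T 0 -> (forall x y, T x -> T y -> T (x + y)) ->
    (forall k x, T x -> T (k *: x)) ->
  exists N, forall x, (x \in N) <-> T x.
Proof.
move=> T0 TD TZ; pose p : {pred M} := fun x => `[< T x >].
have pP : GRing.subsemimod_closed p.
  split; first split.
  - exact/asboolP.
  - by move=> x y /asboolP Tx /asboolP Ty; apply/asboolP/TD.
  - by move=> k x /asboolP Tx; apply/asboolP/TZ.
pose N : submodClosed M := HB.pack (p : M -> bool)
  (GRing.isSubmodClosed.Build A M (p : M -> bool) pP).
by exists N => x; split=> /asboolP.
Qed.

Lemma submodB N x y : x \in N -> y \in N -> x - y \in N.
Proof. by move=> xN yN; apply: (submod_zmod_closed N).2. Qed.

(** Finite length with an explicit natural bound, suited to induction in place of the supremum in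
    [\bar R]. *)
Definition bounded_chains N n :=
  forall k c, submod_chain N k c -> (k <= n)%N.

Lemma submod_length_fin (R : realType) N :
  (submod_length R N < +oo)%E <-> exists n, bounded_chains N n.
Proof.
split=> [fin|[n Nn]].
  have [r rP] : exists r : R, (submod_length R N <= r%:E)%E.
    case E: (submod_length R N) fin => [r| |] // _; first by exists r.
    by exists 0; rewrite leNye.
  exists (Num.truncn r) => k c ck; rewrite -(@ler_nat R).
  have kr : (k%:R%:E <= r%:E :> \bar R)%E.
    apply: le_trans rP; apply: ereal_sup_ubound.
    by exists k => //; exists c.
  rewrite ler_nat; rewrite lee_fin in kr.
  rewrite -ltnS -(ltr_nat R); apply: le_lt_trans kr _.
  exact: truncnS_gt.
apply: (@le_lt_trans _ _ (n%:R%:E)%E); last exact: ltry.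
by apply: ub_ereal_sup => _ [k [c ck] <-]; rewrite lee_fin ler_nat (Nn _ _ ck).
Qed.

(** A chain in [P] can be continued by [N], so it is shorter than [n]; the constant chain of length
    0 shows that [n] is positive. *)
Lemma bounded_chains_proper N P n : submod_lt P N -> bounded_chains N n ->
  (0 < n)%N /\ bounded_chains P n.-1.
Proof.
move=> [PN [x xN xP]] Nn.
have ext k c : submod_chain P k c -> (k < n)%N.
  move=> [cP clt]; apply: (Nn k.+1 (fun i => if (i <= k)%N then c i else N)).
  split=> [i _|i]; first by case: (leqP i k) => ik y // /(cP i ik)/PN.
  rewrite ltnS => ik; rewrite ik; case: ltnP => [/clt //|ki].
  by split=> [y /(cP i ik)/PN //|]; exists x => //;
    apply: contra xP => /(cP i ik).
have n0 : (0 < n)%N by apply: (ext 0 (fun=> P)); split=> // i _ y.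
by split=> // k c /ext; rewrite -[(k <= _)%N]ltnS prednK.
Qed.

Lemma zero_submodP : exists Z : submodClosed M, forall x, (x \in Z) <-> x = 0.
Proof.
by apply: submod_ofP => [|u v -> ->|k u ->] //; rewrite ?addr0 ?scaler0.
Qed.

Lemma bounded_chains0 N x : bounded_chains N 0 -> x \in N -> x = 0.
Proof.
move=> N0 xN; apply: contrapT => x0; have [Z ZP] := zero_submodP.
have [] := @bounded_chains_proper N Z 0 _ N0 => //.
split=> [u /ZP->|]; first exact: rpred0.
by exists x => //; apply/negP => /ZP.
Qed.

(** Induction on the bound: a nonzero [N] that is not simple has a proper nonzero submodule, whose
    bound is smaller. *)
Lemma simple_submod_exists N n : bounded_chains N n ->
  (exists2 x, x \in N & x != 0) ->
  exists2 S, simple_submod S & {subset S <= N}.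
Proof.
elim: n N => [|n IH] N Nn [x xN x0]; have [NS|NS] := pselect (simple_submod N);
  try by exists N.
- by rewrite (bounded_chains0 Nn xN) eqxx in x0.
- have [P [PN P0 NP]] : exists P, [/\ {subset P <= N},
      exists2 u, u \in P & u != 0 & exists2 u, u \in N & u \notin P].
    apply: contrapT => nex; apply: NS; split; first by exists x.
    move=> P PN; have [P0|P0] := pselect (forall x, x \in P -> x = 0);
      first by left.
    right=> u uN; apply: contrapT => uP; apply: nex; exists P; split=> //.
      apply: contrapT => nex; apply: P0 => v vP; apply: contrapT => v0.
      by apply: nex; exists v => //; apply/eqP.
    by exists u => //; apply/negP.
  have [_ Pn] := @bounded_chains_proper N P _ (conj PN NP) Nn.
  have [S SS SP] := IH P Pn P0.
  by exists S => // u /SP/PN.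
Qed.

(* A chain in [N] of length [k + 1] yields one of length [k] in [P]: delete the
   first term not contained in [P] and intersect the later ones with [P]. *)
Lemma bounded_chains_add_simple N P S n : simple_submod S ->
    (forall x, x \in N -> exists y z, [/\ y \in P, z \in S & x = y + z]) ->
  bounded_chains P n -> bounded_chains N n.+1.
Proof.
move=> [_ Smin] NPS Pn [//|k] c [cN clt]; rewrite ltnS.
(* If [Q] is not contained in [P], then [Q + P] contains [N]: the [m] in [S] with [p + m] in [Q] for
   some [p] in [P] form a submodule of [S]. It is nonzero, since otherwise [Q] would lie in [P],
   hence it is all of [S]. *)
have full Q : {subset Q <= N} -> ~ {subset Q <= P} ->
    forall z, z \in N -> exists2 y, y \in Q & z - y \in P.
  move=> QN QP z zN.
  have [S' S'P] : exists S', forall m, (m \in S') <->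
      (m \in S /\ exists2 p, p \in P & p + m \in Q).
    apply: submod_ofP => [|u v [uS [p pP puQ]] [vS [q qP qvQ]]|a u [uS [p pP
      puQ]]].
    - by split; [exact: rpred0|exists 0; rewrite ?addr0 ?rpred0].
    - split; first exact: rpredD.
      by exists (p + q); [exact: rpredD|rewrite addrACA rpredD].
    - split; first exact: rpredZ.
      by exists (a *: p); [exact: rpredZ|rewrite -scalerDr rpredZ].
  have [S'0|SS'] := Smin S' (fun m mS' => ((S'P m).1 mS').1).
    case: QP => x xQ; have [p [m [pP mS xE]]] := NPS x (QN x xQ).
    have m0 : m = 0 by apply/S'0/S'P; split=> //; exists p; rewrite -?xE.
    by rewrite xE m0 addr0.
  have [p [m [pP mS ->]]] := NPS z zN.
  have /S'P[_ [q qP qmQ]] := SS' m mS.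
  by exists (q + m) => //; rewrite opprD addrACA subrr addr0 submodB.
have capP Q : exists Q' : submodClosed M, forall x,
  (x \in Q') <-> (x \in Q /\ x \in P).
  apply: submod_ofP => [|u v [uQ uP] [vQ vP]|a u [uQ uP]]; split;
    by rewrite ?rpred0 ?rpredD ?rpredZ.
pose cap Q := sval (cid (capP Q)).
have capE Q x : (x \in cap Q) <->
  (x \in Q /\ x \in P) by exact: svalP (cid (capP Q)) x.
apply: (Pn k (fun i => if `[< {subset c i <= P} >] then c i else cap (c i.+1))).
have cS i x : (i < k.+1)%N -> x \in c i ->
  x \in c i.+1 by move=> /clt[+ _] => /[apply].
(* Strictness survives intersection with [P]: [full] corrects an element [z] of [c i.+2] by some [y]
   of [c i.+1] so that [z - y] lies in [P]. *)
have cut i : (i < k)%N -> ~ {subset c i.+1 <= P} ->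
    exists2 x, x \in cap (c i.+2) & x \notin c i.+1.
  move=> ik nP; have [sub [z z2 z1]] := clt i.+1 ik.
  have ik2 : (i.+1 <= k.+1)%N by apply: leqW.
  have [y y1 zyP] := full _ (cN i.+1 ik2) nP z (cN i.+2 ik z z2).
  exists (z - y); first by apply/capE; split=> //; apply: submodB => //;
    apply: sub.
  by apply: contra z1 => zy; rewrite -(subrK y z) rpredD.
split=> [i ik|i ik].
  by case: asboolP => // _ x /capE[].
have ik1 : (i < k.+1)%N by apply: leqW.
case: asboolP => [ciP|nciP]; case: asboolP => [ci1P|nci1P].
- exact: clt.
- have [x x2 x1] := cut i ik nci1P.
  split=> [u ui|]; first by apply/capE; split; [exact/(cS i.+1)/cS|apply: ciP].
  by exists x => //; apply: contra x1; apply: cS.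
- by case: nciP => x /(cS i x ik1)/ci1P.
- have [x x2 x1] := cut i ik nci1P.
  split=> [u /capE[ui uP]|]; first by apply/capE; split=> //; apply: cS.
  by exists x => //; apply: contra x1 => /capE[].
Qed.

(** The generator is a finite sum of elements of simple submodules. Adding these submodules one by
    one to zero raises the bound by one each time and ends with a submodule containing [g], hence
    everything. *)
Lemma bounded_chains_cyclic (g : M) : (forall x, exists k, x = k *: g) ->
  g \in socle M -> exists n, bounded_chains (full_submod M) n.
Proof.
move=> gen /asboolP[s sS gE].
suff [n [P Pn sP]] : exists n, exists2 P, bounded_chains P n &
    \sum_(y <- s) y \in P.
  exists n => k c [_ clt]; apply: (Pn k c); split=> // i _ x _.
  by have [a ->] := gen x; rewrite gE rpredZ.
elim: s sS {gE} => [_|y s IH sS].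
  have [Z ZP] := zero_submodP.
  exists 0; exists Z; last by apply/ZP; rewrite big_nil.
  move=> [//|k] c [cZ /(_ 0 isT)[_ [x x1 /negP[]]]].
  by move/(cZ 1 isT)/ZP: x1 => ->; apply: rpred0.
have [|n [P Pn sP]] := IH; first by move=> z zs; apply: sS;
  rewrite in_cons zs orbT.
have [S SS yS] := sS y (mem_head _ _).
have [N NP] : exists N : submodClosed M, forall x, (x \in N) <->
    exists u v, [/\ u \in P, v \in S & x = u + v].
  apply: submod_ofP => [|_ _ [u [v [uP vS ->]]] [w [z [wP zS ->]]]|a _ [u [v
    [uP vS ->]]]].
  - by exists 0, 0; rewrite !rpred0 addr0.
  - by exists (u + w), (v + z); rewrite !rpredD // addrACA.
  - by exists (a *: u), (a *: v); rewrite !rpredZ // scalerDr.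
exists n.+1, N.
  by apply: (bounded_chains_add_simple SS _ Pn) => x /NP.
by apply/NP; exists (\sum_(j <- s) j), y; rewrite big_cons addrC.
Qed.

End Submodules.

(** Strictly monotone maps send chains to chains. Two rings occur because the involution passes
    between modules over [A] and over [A^c]. *)
Lemma bounded_chains_transport (A B : pzRingType) (M : lmodType A)
    (M' : lmodType B) (N : submodClosed M) (N' : submodClosed M')
    (F : submodClosed M -> submodClosed M') n :
    (forall P : submodClosed M, {subset P <= N} -> {subset F P <= N'}) ->
    (forall P Q : submodClosed M, {subset P <= N} -> {subset Q <= N} ->
      submod_lt P Q -> submod_lt (F P) (F Q)) ->
  bounded_chains N' n -> bounded_chains N n.
Proof.
move=> FN Flt N'n k c [cN clt]; apply: (N'n k (F \o c)); split=> i ik.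
  exact/FN/cN.
exact: Flt (cN i (ltnW ik)) (cN i.+1 ik) (clt i ik).
Qed.

(** The image of a simple submodule is zero or simple, as seen by pulling submodules of the image
    back to [N]. *)
Lemma socle_hom (A : pzRingType) (M M' : lmodType A) (f : M -> M') :
    {morph f : x y / x + y} -> scalable f ->
  forall x, x \in socle M -> f x \in socle M'.
Proof.
move=> fD fZ; have f0 : f 0 = 0 by have := fZ 0 0; rewrite !scale0r.
move=> x /asboolP[s sN ->]; rewrite (big_morph f fD f0) big_seq.
apply: rpred_sum => y /sN[N [_ Nmin] yN].
have [->|fy0] := eqVneq (f y) 0; first exact: rpred0.
have [FN FNP] : exists FN : submodClosed M', forall u, (u \in FN) <->
    exists2 v, v \in N & u = f v.
  apply: submod_ofP => [|_ _ [u uN ->] [v vN ->]|a _ [u uN ->]].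
  - by exists 0; rewrite ?rpred0 ?f0.
  - by exists (u + v); rewrite ?rpredD ?fD.
  - by exists (a *: u); rewrite ?rpredZ ?fZ.
apply/asboolP; exists [:: f y]; last by rewrite big_seq1.
move=> z; rewrite inE => /eqP->; exists FN; last by apply/FNP; exists y.
split=> [|P PFN]; first by exists (f y) => //; apply/FNP; exists y.
have [Q QP] : exists Q : submodClosed M, forall u, (u \in Q) <->
    (u \in N /\ f u \in P).
  apply: submod_ofP => [|u v [uN uP] [vN vP]|a u [uN uP]].
  - by rewrite f0 !rpred0.
  - by rewrite fD !rpredD.
  - by rewrite fZ !rpredZ.
have [Q0|NQ] := Nmin Q (fun u uQ => ((QP u).1 uQ).1).
  left=> u uP; have /FNP[v vN uE] := PFN u uP.
  by rewrite uE (Q0 v) //; apply/QP; rewrite -uE.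
by right=> u /FNP[v vN ->]; have /QP[] := NQ v vN.
Qed.

(** * Submodules and chains of a quotient module *)

Section QuotientChains.
Variables (A : pzRingType) (M : lmodType A) (N : submodClosed M).

Lemma to_quot_modE x y :
  (to_quot_mod N x = to_quot_mod N y) <-> (x - y \in N).
Proof. by split=> /to_quot_modP. Qed.

Lemma to_quot_mod_surj (u : quot_mod N) : exists x, u = to_quot_mod N x.
Proof. by exists (repr (u : Quotient.quot (submod_zmod N)));
  rewrite to_quot_modK. Qed.

Lemma scale_to_quot_mod a x : a *: to_quot_mod N x = to_quot_mod N (a *: x).
Proof. exact: to_quot_modZ. Qed.

Lemma to_quot_mod0 : to_quot_mod N 0 = 0.
Proof. by rewrite -(scale0r 0) -scale_to_quot_mod scale0r. Qed.

Lemma quot_submodP (P : submodClosed M) :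
  exists Q : submodClosed (quot_mod N),
    forall u, (u \in Q) <-> exists2 x, x \in P & u = to_quot_mod N x.
Proof.
apply: submod_ofP => [|_ _ [x xP ->] [y yP ->]|a _ [x xP ->]].
- by exists 0; rewrite ?rpred0 ?to_quot_mod0.
- by exists (x + y); rewrite ?rpredD ?to_quot_modD.
- by exists (a *: x); rewrite ?rpredZ ?scale_to_quot_mod.
Qed.

(** All [L i] contain [N], so strict inclusions among them remain strict in the quotient, where
    [n + 1] consecutive ones would exceed the bound. *)
Lemma quot_chain_stabilises n (L : nat -> submodClosed M) :
    bounded_chains (full_submod (quot_mod N)) n ->
    (forall i, {subset N <= L i}) -> (forall i, {subset L i <= L i.+1}) ->
  exists i, {subset L i.+1 <= L i}.
Proof.
move=> Mn NL LS; apply: contrapT => nex.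
pose c i := sval (cid (quot_submodP (L i))).
have cE i u : (u \in c i) <-> exists2 x, x \in L i & u = to_quot_mod N x.
  exact: svalP (cid (quot_submodP (L i))) u.
suff : (n.+1 <= n)%N by rewrite ltnn.
apply: (Mn n.+1 c); split=> // i _; split.
  by move=> _ /cE[x xL ->]; apply/cE; exists x => //; apply: LS.
have /existsNP[x /not_implyP[xS xL]] : ~ {subset L i.+1 <= L i}.
  by move=> sub; apply: nex; exists i.
exists (to_quot_mod N x); first by apply/cE; exists x.
apply/negP => /cE[y yL /to_quot_modE xy]; apply: xL.
by rewrite -(subrK y x) rpredD //; apply: (NL i).
Qed.

End QuotientChains.

(** * Brauer's lemma and the socle *)

Section CStarRing.
Variables (R : realType) (A : cstarAlgType R).
Implicit Types (x y e g : A) (L S : submodClosed A^o).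

Lemma cstar_starM x y : star (x * y) = star y * star x.
Proof. exact: starM. Qed.

Lemma cstar_star0 : star (0 : A) = 0.
Proof. by apply: (addrI (star (0 : A))); rewrite -starD !addr0. Qed.

Lemma cstar_starN x : star (- x) = - star x.
Proof. by apply: (addrI (star x)); rewrite -starD !subrr cstar_star0. Qed.

Lemma cstar_starB x y : star (x - y) = star x - star y.
Proof. by rewrite starD cstar_starN. Qed.

Lemma cstar_star1 : star (1 : A) = 1.
Proof.
have : star (1 * star (1 : A)) = star 1 by rewrite cstar_starM starK mul1r.
by rewrite mul1r starK => <-.
Qed.

Lemma normM_le x y : `|x * y| <= `|x| * `|y|.
Proof. exact: cstar_normM. Qed.

Lemma norm_starM x : `|star x * x| = `|x| ^+ 2.
Proof. exact: cstar_normE. Qed.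

Lemma star_mul_eq0 x : star x * x = 0 -> x = 0.
Proof.
move=> xx0; apply/normr0_eq0/eqP; rewrite -sqrf_eq0.
by rewrite -norm_starM xx0 normr0.
Qed.

(* Brauer's lemma; a nonzero [x \in S] gives a selfadjoint [y = x^* x \in S]
   with [y y <> 0], so that [S y = S]. *)
Lemma simple_left_ideal_idempotent S : simple_submod S ->
  exists g, [/\ g \in S, g * g = g, g != 0 & forall x, x \in S -> x * g = x].
Proof.
move=> [[x xS x0] Smin].
pose y : A := star x * x.
have yS : (y : A^o) \in S by exact: (rpredZ (star x) xS).
have y0 : y * y != 0.
  have sy : star y = y by rewrite cstar_starM starK.
  by apply/eqP; rewrite -{1}sy => /star_mul_eq0/star_mul_eq0/eqP;
    rewrite (negPf x0).
have [Sy SyP] : exists N : submodClosed A^o, forall z, (z \in N) <->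
    exists2 u : A, (u : A^o) \in S & z = u * y.
  apply: submod_ofP => [|_ _ [u uS ->] [v vS ->]|k _ [u uS ->]].
  - by exists 0; rewrite ?rpred0 ?mul0r.
  - by exists (u + v); rewrite ?rpredD ?mulrDl.
  - by exists (k * u); [exact: (rpredZ k uS)|exact: mulrA].
have SySub : {subset Sy <= S} by move=> z /SyP[u _ ->]; exact: (rpredZ u yS).
have [Sy0|SSy] := Smin _ SySub.
  by move/eqP: y0; case; apply/Sy0/SyP; exists y.
(* As [S = S y], some [g] in [S] satisfies [y = g y]. The kernel [K] of right multiplication by [y]
   on [S] is zero by simplicity, and it contains every [z - z g]. *)
have /SyP[g gS gy] := SSy _ yS.
have [K KP] : exists N : submodClosed A^o, forall z, (z \in N) <->
    (z \in S /\ (z : A) * y = 0).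
  apply: submod_ofP => [|u v [uS uy] [vS vy]|k u [uS uy]].
  - by rewrite rpred0 mul0r.
  - by rewrite rpredD // mulrDl uy vy addr0.
  - by rewrite rpredZ //; split=> //;
      rewrite -[k *: u]/(k * (u : A)) -mulrA uy mulr0.
have [K0|SK] := Smin K (fun z zK => ((KP z).1 zK).1); last first.
  by have /KP[_ yy] := SK _ yS; rewrite yy eqxx in y0.
have xgx z : (z : A^o) \in S -> z * g = z.
  move=> zS; apply/eqP; rewrite -subr_eq0; apply/eqP/K0/KP; split.
    by apply: submodB => //; exact: (rpredZ z gS).
  by rewrite mulrBl -mulrA -gy subrr.
exists g; split=> //; first exact: xgx.
by apply: contra y0 => /eqP g0; rewrite gy g0 !(mul0r, mulr0).
Qed.

(** Split [x = x g + (x - x g)] with an idempotent [g] of a simple left ideal inside [L]. The first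
    term is in the socle; the second lies in the part of [L] killed by [g], which is proper since it
    misses [g], so induction applies. *)
Lemma finite_length_sub_socle L n : bounded_chains L n ->
  {subset L <= socle A^o}.
Proof.
elim: n L => [|n IH] L Ln x xL.
  by rewrite (bounded_chains0 Ln xL) rpred0.
have [->|x0] := eqVneq x 0; first exact: rpred0.
have Lx : exists2 x, x \in L & x != 0 by exists x.
have [S SS SL] := simple_submod_exists Ln Lx.
have [g [gS gg g0 _]] := simple_left_ideal_idempotent SS.
have [K KP] : exists N : submodClosed A^o, forall z, (z \in N) <->
    (z \in L /\ (z : A) * g = 0).
  apply: submod_ofP => [|u v [uS uy] [vS vy]|k u [uS uy]].
  - by rewrite rpred0 mul0r.
  - by rewrite rpredD // mulrDl uy vy addr0.
  - by rewrite rpredZ //; split=> //;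
      rewrite -[k *: u]/(k * (u : A)) -mulrA uy mulr0.
have [|_ Kn] := @bounded_chains_proper _ _ L K n.+1 _ Ln.
  split=> [z /KP[] //|]; exists g; first exact: SL.
  by apply/negP => /KP[_]; rewrite gg => /eqP; rewrite (negPf g0).
have gs : (g : A^o) \in socle A^o.
  apply/asboolP; exists [:: g]; last by rewrite big_seq1.
  by move=> z; rewrite inE => /eqP->; exists S.
have xgs : ((x : A) * g : A^o) \in socle A^o by exact: (rpredZ x gs).
rewrite -(subrK ((x : A) * g : A^o) x) rpredD //.
apply: (IH K Kn); apply/KP; split.
  by apply: submodB => //; exact: (rpredZ x (SL _ gS)).
by rewrite mulrBl -mulrA gg subrr.
Qed.

End CStarRing.

(** * Left ideals generated by a projection *)

Section PrincipalProjection.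
Variables (R : realType) (A : cstarAlgType R).
Implicit Types (a b v x y e : A).

Lemma lprincipalP a x : ((x : A^o) \in lprincipal a) <-> exists b, x = b * a.
Proof. by split=> /asboolP. Qed.

Lemma rann_lprincipalP a x :
  (x \in (rann (lprincipal a) : {pred (A^c)^o})) <-> a * x = 0.
Proof.
split=> [/asboolP xL|ax0].
  by apply: xL; apply/lprincipalP; exists 1; rewrite mul1r.
by apply/asboolP => _ /lprincipalP[b ->]; rewrite -mulrA ax0 mulr0.
Qed.

(** This says [A a = A e] for a projection [e]: the left ideal of an idempotent consists of the
    elements that it fixes from the right. *)
Definition lprincipal_proj a e :=
  [/\ star e = e, e * e = e & forall x,
    ((x : A^o) \in lprincipal a) <-> x * e = x].

(** Taking adjoints gives [v = v^2 b^*], hence [b v = b v^2 b^* = v b^*]. So [b v] is selfadjoint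
    and acts as a unit on [v] from both sides. *)
Lemma projection_of_square v b : star v = v -> v = b * (v * v) ->
  exists e, [/\ star e = e, e * e = e, v * e = v & e = b * v].
Proof.
move=> sv vE; have vE' : v = v * v * star b.
  by rewrite -{1}sv {1}vE !cstar_starM sv.
have bv : b * v = v * star b by rewrite {1}vE' mulrA -vE.
have se : star (b * v) = b * v by rewrite cstar_starM sv.
have ev : b * v * v = v by rewrite -mulrA -vE.
exists (b * v); split=> //; first by rewrite {2}bv !mulrA ev -bv.
by rewrite bv mulrA -vE'.
Qed.

Variables (a e : A).
Hypothesis ae : lprincipal_proj a e.

Let se : star e = e. Proof. by case: ae. Qed.
Let ee : e * e = e. Proof. by case: ae. Qed.
Let aeP x : ((x : A^o) \in lprincipal a) <-> x * e = x.
Proof. by case: ae => _ _; apply. Qed.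

Let mul_a_eq0 x : (a * x = 0) <-> (e * x = 0).
Proof.
split=> [ax0|ex0].
  have /lprincipalP[b eb] : (e : A^o) \in lprincipal a by apply/aeP.
  by rewrite eb -mulrA ax0 mulr0.
have <- : a * e = a by apply/aeP/lprincipalP; exists 1; rewrite mul1r.
by rewrite -mulrA ex0 mulr0.
Qed.

Local Notation Q := (full_submod (quot_mod (lprincipal a))).

(** The left ideal [L = A (1 - e)] meets [A a] in zero, so it embeds into the quotient and has
    finite length. *)
Lemma finite_length_compl n : bounded_chains Q n ->
  (1 - e : A^o) \in socle A^o.
Proof.
move=> Qn; have [L LP] : exists N : submodClosed A^o, forall z, (z \in N) <->
    (z : A) * e = 0.
  apply: submod_ofP => [|u v ue ve|k u ue].
  - by rewrite mul0r.
  - by rewrite mulrDl ue ve addr0.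
  - by rewrite -[k *: u]/(k * (u : A)) -mulrA ue mulr0.
suff Ln : bounded_chains L n.
  by apply: (finite_length_sub_socle Ln); apply/LP;
    rewrite mulrBl ee mul1r subrr.
pose F P := sval (cid (quot_submodP (lprincipal a) P)).
have FP P u : (u \in F P) <-> exists2 x,
  x \in P & u = to_quot_mod (lprincipal a) x.
  exact: svalP (cid (quot_submodP (lprincipal a) P)) u.
apply: (bounded_chains_transport (F :=
  F) _ _ Qn) => // P P' PL P'L [PP' [x xP' xP]].
split=> [_ /FP[y yP ->]|]; first by apply/FP; exists y => //; apply: PP'.
exists (to_quot_mod (lprincipal a) x); first by apply/FP; exists x.
apply/negP => /FP[y yP /to_quot_modE/aeP].
have /LP xe := P'L x xP'; have /LP ye := PL y yP.
rewrite mulrBl xe ye subrr => /esym/eqP; rewrite subr_eq0 => /eqP xy.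
by rewrite xy yP in xP.
Qed.

(** A right ideal [P] inside [(1 - e) A] is sent to the image of [P^*] in the quotient; [P^*] lies
    in [A (1 - e)], where the quotient map is injective. *)
Lemma finite_length_rann n : bounded_chains Q n ->
  bounded_chains (rann (lprincipal a)) n.
Proof.
move=> Qn.
have FP (P : submodClosed (A^c)^o) : exists Q : submodClosed (quot_mod
  (lprincipal a)),
    forall u, (u \in Q) <-> exists2 x : A, (star x \in P) &
      u = to_quot_mod (lprincipal a) (x : A^o).
  apply: submod_ofP => [|_ _ [x xP ->] [y yP ->]|k _ [x xP ->]].
  - by exists 0; [rewrite cstar_star0; exact: (rpred0 P)|rewrite to_quot_mod0].
  - exists (x + y); last by rewrite to_quot_modD.
    by rewrite starD; exact: (rpredD xP yP).
  - exists (k * x); last by rewrite scale_to_quot_mod.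
    by rewrite cstar_starM; exact: (rpredZ (star k : A^c) xP).
pose F P := sval (cid (FP P)).
have FE P u : (u \in F P) <-> exists2 x : A, (star x \in P) &
    u = to_quot_mod (lprincipal a) (x : A^o) by exact: svalP (cid (FP P)) u.
apply: (bounded_chains_transport (F :=
  F) _ _ Qn) => // P P' PL P'L [PP' [x xP' xP]].
have ann z : star z \in rann (lprincipal a) -> z * e = 0.
  by move=> /rann_lprincipalP/mul_a_eq0 ez;
    rewrite -(starK (z * e)) cstar_starM se ez cstar_star0.
split=> [_ /FE[y yP ->]|]; first by apply/FE; exists y => //; apply: PP'.
exists (to_quot_mod (lprincipal a) (star x : A^o)); first by apply/FE;
  exists (star x); rewrite ?starK.
apply/negP => /FE[y yP /to_quot_modE/aeP].
have xe : star x * e = 0 by apply/ann; rewrite starK; apply: P'L.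
rewrite mulrBl xe (ann y (PL _ yP)) subrr => /esym/eqP;
  rewrite subr_eq0 => /eqP xy.
by rewrite -(starK x) xy yP in xP.
Qed.

(** The opposite transport: a submodule of the quotient is sent to the adjoints of its
    representatives in [A (1 - e)]. *)
Lemma finite_length_of_rann n : bounded_chains (rann (lprincipal a)) n ->
  bounded_chains Q n.
Proof.
move=> rn.
have FP (P : submodClosed (quot_mod (lprincipal a))) :
    exists P' : submodClosed (A^c)^o,
    forall x : A, (x \in P') <->
      (e * x = 0 /\ to_quot_mod (lprincipal a) (star x : A^o) \in P).
  apply: submod_ofP => [|x y [ex xP] [ey yP]|k x [ex xP]].
  - by rewrite mulr0 cstar_star0 to_quot_mod0 rpred0.
  - by rewrite mulrDr ex ey addr0 starD to_quot_modD rpredD.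
  - rewrite -[k *: x]/((x : A) * (k : A)) mulrA ex mul0r cstar_starM.
    by split=> //; have := rpredZ (star k) xP; rewrite scale_to_quot_mod.
pose F P := sval (cid (FP P)).
have FE P x : (x \in F P) <-> (e * x = 0 /\
    to_quot_mod (lprincipal a) (star x : A^o) \in P).
  exact: svalP (cid (FP P)) x.
apply: (bounded_chains_transport (F :=
  F) _ _ rn) => [P _ x|P P' _ _ [PP' [u uP' uP]]].
  by move=> /FE[ex _]; apply/rann_lprincipalP/mul_a_eq0.
split=> [x /FE[ex xP]|]; first by apply/FE; split=> //; apply: PP'.
have [z uz] := to_quot_mod_surj u.
(* Each class has a representative in [A (1 - e)], because [z - z (1 - e) = z e] lies in [A a]. *)
have zE : u = to_quot_mod (lprincipal a) (star (star (z * (1 - e) : A)) : A^o).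
  rewrite starK uz; apply/to_quot_modE/aeP.
  by rewrite mulrBr mulr1 opprB addrC subrK -mulrA ee.
exists (star (z * (1 - e) : A)).
  apply/FE; split; last by rewrite -zE.
  by rewrite cstar_starM cstar_starB cstar_star1 se mulrA mulrBr mulr1 ee subrr
    mul0r.
by apply/negP => /FE[_]; rewrite -zE => uP1; rewrite uP1 in uP.
Qed.

End PrincipalProjection.

(** * The real-valued norm and Neumann series *)

Section CStarNorm.
Variables (R : realType) (A : cstarAlgType R).
Implicit Types (x y : A) (t q C : R) (u : nat -> A).

(** The norm has values in [R[i]]; its real part makes real arithmetic and its decision procedures
    available. *)
Definition cnorm x : R := complex.Re `|x|.

Lemma cnormE x : `|x| = (cnorm x)%:C%C.
Proof. by rewrite /cnorm RRe_real // ger0_real. Qed.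

Lemma cnorm_ge0 x : 0 <= cnorm x.
Proof. by rewrite -ler0c -cnormE. Qed.

Lemma cnorm0 : cnorm 0 = 0.
Proof. by rewrite /cnorm normr0. Qed.

Lemma cnorm_eq0 x : cnorm x = 0 -> x = 0.
Proof. by move=> x0; apply: normr0_eq0; rewrite cnormE x0. Qed.

Lemma cnormD x y : cnorm (x + y) <= cnorm x + cnorm y.
Proof. by rewrite -lecR rmorphD /= -!cnormE ler_normD. Qed.

Lemma cnormN x : cnorm (- x) = cnorm x.
Proof. by rewrite /cnorm normrN. Qed.

Lemma cnormC x y : cnorm (x - y) = cnorm (y - x).
Proof. by rewrite /cnorm distrC. Qed.

Lemma cnormB x y : cnorm (x - y) <= cnorm x + cnorm y.
Proof. by rewrite -(cnormN y) cnormD. Qed.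

Lemma cnormM x y : cnorm (x * y) <= cnorm x * cnorm y.
Proof. by rewrite -lecR rmorphM /= -!cnormE normM_le. Qed.

Lemma cnorm_starM x : cnorm (star x * x) = cnorm x ^+ 2.
Proof. by apply: complexI; rewrite rmorphXn /= -!cnormE norm_starM. Qed.

Lemma cnormZ (k : R[i]) x : cnorm (k *: x) = complex.Re `|k| * cnorm x.
Proof.
by apply: complexI; rewrite -cnormE normrZ cnormE rmorphM /= RRe_real //
  ger0_real.
Qed.

Lemma cnormZr t x : cnorm (t%:C%C *: x) = `|t| * cnorm x.
Proof. by rewrite cnormZ normc_def /= expr0n addr0 sqrtr_sqr. Qed.

Lemma cnormZi t x : cnorm ((Complex 0 t) *: x) = `|t| * cnorm x.
Proof. by rewrite cnormZ normc_def /= expr0n add0r sqrtr_sqr. Qed.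

(** The C*-identity gives [||1|| = ||1||^2], so the norm of [1] is 0 or 1; it is 0 in the zero
    algebra. *)
Lemma cnorm1_le1 : cnorm 1 <= 1.
Proof.
have := cnorm_starM 1; rewrite cstar_star1 mulr1 => e1.
have := cnorm_ge0 1; nra.
Qed.

Lemma cnorm_star_le x : cnorm x <= cnorm (star x).
Proof.
have [x0|x0] := eqVneq (cnorm x) 0; first by rewrite x0 cnorm_ge0.
have := cnormM (star x) x; rewrite cnorm_starM expr2 ler_pM2r //.
by rewrite lt_neqAle eq_sym x0 cnorm_ge0.
Qed.

Lemma cnorm_star x : cnorm (star x) = cnorm x.
Proof.
by apply/eqP; rewrite eq_le cnorm_star_le -{2}(starK x) cnorm_star_le.
Qed.

Lemma closure_cnormP (S : set A) x :
  closure S x <-> forall t, 0 < t -> exists2 y, S y & cnorm (x - y) < t.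
Proof.
split=> [xS t t0|xS B /nbhs_ballP[t t0 tB]].
  have [|y [Sy]] := xS (ball x t%:C%C); first by apply: nbhsx_ballx;
    rewrite ltcR.
  by rewrite -ball_normE /= cnormE ltcR; exists y.
have tr : t = (complex.Re t)%:C%C by rewrite RRe_real // gtr0_real.
have [|y Sy xy] := xS (complex.Re t); first by rewrite -ltcR -tr.
by exists y; split=> //; apply: tB; rewrite -ball_normE /= cnormE tr ltcR.
Qed.

Lemma closed_cnormP (S : set A) x : closed S ->
  (forall t, 0 < t -> exists2 y, S y & cnorm (x - y) < t) -> S x.
Proof. by move=> /closure_id{2}-> /closure_cnormP. Qed.

Lemma geometric_lt C q t : 0 <= q -> q < 1 -> 0 < t ->
  exists n, C * q ^+ n < t.
Proof.
move=> q0 q1 t0; have qn : `|q| < 1 by rewrite ger0_norm.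
have /cvgrPdist_lt/(_ (t / (`|C| + 1)))[|N _ /(_ N (leqnn N))] := cvg_expr qn.
  by rewrite divr_gt0 // ltr_wpDl.
rewrite /= sub0r normrN ger0_norm ?exprn_ge0 // ltr_pdivlMr ?ltr_wpDl // => qN.
exists N; apply: le_lt_trans qN; rewrite mulrC ler_wpM2l ?exprn_ge0 //.
by rewrite (le_trans (ler_norm _)) // lerDl.
Qed.

Lemma geometric_eq0 C q x : 0 <= q -> q < 1 ->
  (forall n, cnorm x <= C * q ^+ n) -> x = 0.
Proof.
move=> q0 q1 xq; apply/cnorm_eq0/eqP; rewrite eq_le cnorm_ge0 andbT.
apply/ler_addgt0Pr => t /(geometric_lt C q0 q1)[n /ltW nt].
by rewrite add0r (le_trans (xq n)).
Qed.

Lemma cvg_of_geometric C q u : 0 <= q -> q < 1 ->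
    (forall n, cnorm (u n.+1 - u n) <= C * q ^+ n) ->
  exists l, forall n, cnorm (l - u n) <= C / (1 - q) * q ^+ n.
Proof.
move=> q0 q1 uq; have p0 : 0 < 1 - q by rewrite subr_gt0.
have C0 : 0 <= C by rewrite (le_trans (cnorm_ge0 _) (le_trans (uq 0) _)) ?expr0
  ?mulr1.
have tail n m : cnorm (u (m + n)%N - u n) <= C / (1 - q) * q ^+ n.
  (* The additional factor [1 - q^m] gives the exact geometric sum, which makes the induction
     close. *)
  suff : cnorm (u (m + n)%N - u n) <= C / (1 - q) * q ^+ n * (1 - q ^+ m).
    move/le_trans; apply; rewrite ler_piMr ?lerBlDr ?lerDl ?exprn_ge0 //.
    by rewrite mulr_ge0 ?exprn_ge0 // divr_ge0 // ltW.
  elim: m => [|m IH]; first by rewrite subrr cnorm0 subrr mulr0.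
  rewrite -(subrK (u (m + n)%N) (u (m.+1 + n)%N)) -addrA.
  apply: le_trans (cnormD _ _) _; apply: le_trans (lerD (uq _) IH) _.
  rewrite le_eqVlt; apply/orP; left; apply/eqP; rewrite exprD exprS.
  by field; rewrite subr_eq0 gt_eqF.
have cu : cauchy (u @ \oo).
  apply: cauchy_exP => eps eps0.
  have er : eps = (complex.Re eps)%:C%C by rewrite RRe_real // gtr0_real.
  have e0 : 0 < complex.Re eps by rewrite -ltcR -er.
  have [n nP] := geometric_lt (C / (1 - q)) q0 q1 e0.
  exists (u n); exists n => // k /= nk; rewrite -ball_normE /=.
  rewrite cnormE er ltcR cnormC; apply: le_lt_trans nP.
  by rewrite -(subnK nk); exact: tail.
have [l /cvgrPdist_lt ul] := (cvg_ex (u @ \oo)).1 (cauchy_cvg _ cu).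
exists l => n; apply/ler_addgt0Pr => t t0.
have [|N _ NP] := ul t%:C%C; first by rewrite ltcR.
have := NP (N + n)%N (leq_addr n N); rewrite /= cnormE ltcR => lt.
rewrite -(subrK (u (N + n)%N) l) -addrA (le_trans (cnormD _ _)) //.
by rewrite [leRHS]addrC lerD ?tail ?ltW.
Qed.

Lemma neumann_inverse x : cnorm x < 1 ->
  exists y, y * (1 - x) = 1 /\ (1 - x) * y = 1.
Proof.
move=> x1; have x0 := cnorm_ge0 x.
have xn n : cnorm (x ^+ n) <= cnorm x ^+ n.
  elim: n => [|n IH]; first exact: cnorm1_le1.
  by rewrite !exprS (le_trans (cnormM _ _)) // ler_wpM2l.
pose u n := \sum_(k < n) x ^+ k.
have uS n : u n.+1 - u n = x ^+ n by rewrite /u big_ord_recr addrC addrA addNr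
  add0r.
have [|l lP] := @cvg_of_geometric 1 (cnorm x) u x0 x1.
  by move=> n; rewrite uS mul1r.
move: (1 / (1 - cnorm x)) lP => D lP.
have uxl n : u n * (1 - x) = 1 - x ^+ n.
  elim: n => [|n IH]; first by rewrite /u big_ord0 mul0r expr0 subrr.
  rewrite -(subrK (u n) (u n.+1)) uS mulrDl IH mulrBr mulr1 -exprSr.
  by rewrite addrC addrA subrK.
have uxr n : (1 - x) * u n = 1 - x ^+ n.
  elim: n => [|n IH]; first by rewrite /u big_ord0 mulr0 expr0 subrr.
  rewrite -(subrK (u n) (u n.+1)) uS mulrDr IH mulrBl mul1r -exprS.
  by rewrite addrC addrA subrK.
exists l; split; apply/eqP; rewrite -subr_eq0; apply/eqP;
  apply: (@geometric_eq0 (D * cnorm (1 - x) + 1) (cnorm x)) => // n.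
  have -> : l * (1 - x) - 1 = (l - u n) * (1 - x) - x ^+ n.
    by rewrite mulrBl uxl opprB -addrA addrAC subrr add0r.
  apply: le_trans (cnormB _ _) _; rewrite [leRHS]mulrDl mul1r lerD //.
  by apply: le_trans (cnormM _ _) _;
    rewrite [leRHS]mulrAC ler_wpM2r ?cnorm_ge0 ?lP.
have -> : (1 - x) * l - 1 = (1 - x) * (l - u n) - x ^+ n.
  by rewrite mulrBr uxr opprB -addrA addrAC subrr add0r.
apply: le_trans (cnormB _ _) _; rewrite [leRHS]mulrDl mul1r lerD //.
by apply: le_trans (cnormM _ _) _;
  rewrite [leLHS]mulrC [leRHS]mulrAC ler_wpM2r ?cnorm_ge0 ?lP.
Qed.

End CStarNorm.

(** * Resolvents of selfadjoint elements *)

Section Resolvent.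
Variables (R : realType) (A : cstarAlgType R).
Implicit Types (x y h : A) (s t : R) (k : R[i]).

Lemma cstar_scaleAl k x y : (k *: x) * y = k *: (x * y).
Proof. exact: esym (cstar_scalerAl k x y). Qed.

Lemma cstar_scaleAr k x y : x * (k *: y) = k *: (x * y).
Proof. exact: esym (cstar_scalerAr k x y). Qed.

Lemma star_scale_real t x : star (t%:C%C *: x) = t%:C%C *: star x.
Proof. by rewrite starZ conjc_real. Qed.

Definition imag t : A := (Complex 0 t : R[i]) *: (1 : A).

Lemma imagC t x : imag t * x = x * imag t.
Proof. by rewrite cstar_scaleAl cstar_scaleAr mul1r mulr1. Qed.

Lemma imagE t x : imag t * x = Complex 0 t *: x.
Proof. by rewrite cstar_scaleAl mul1r. Qed.

Lemma imagD s t : imag (s + t) = imag s + imag t.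
Proof. by rewrite /imag -scalerDl; congr (_ *: _);
  rewrite -[RHS]/(Complex _ _) addr0. Qed.

Lemma imag_sqr t : imag t * imag t = - ((t ^+ 2)%:C%C *: (1 : A)).
Proof.
rewrite imagE /imag scalerA -scaleNr; congr (_ *: _).
by apply/eqP; rewrite eq_complex /=; apply/andP; split; apply/eqP; ring.
Qed.

Lemma star_imag t : star (imag t) = - imag t.
Proof.
rewrite /imag starZ cstar_star1 -scaleNr; congr (_ *: _).
by apply/eqP; rewrite eq_complex /= oppr0 !eqxx.
Qed.

Lemma imag_mulBD t x :
  (x - imag t) * (x + imag t) = x * x + (t ^+ 2)%:C%C *: (1 : A).
Proof.
by rewrite mulrDr !mulrBl imag_sqr opprK imagC addrA subrK.
Qed.

Lemma imag_mulDB t x :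
  (x + imag t) * (x - imag t) = x * x + (t ^+ 2)%:C%C *: (1 : A).
Proof.
by rewrite mulrBr !mulrDl imag_sqr imagC opprD opprK addrA addrK.
Qed.

Lemma comm_inverse x y z : z * y = 1 -> y * z = 1 -> x * y = y * x ->
  x * z = z * x.
Proof. by move=> zy yz xy;
  rewrite -[LHS]mul1r -zy -!mulrA (mulrA y) -xy -mulrA yz mulr1. Qed.

(** Write [h + i s = (h - i t) + i (s + t)]. A Neumann series applies once [||h - i t|| < s + t];
    with [s t = ||h||^2] this follows from [||h - i t||^2 <= ||h||^2 + t^2]. *)
Lemma selfadjoint_shift_inverse h s : star h = h -> 0 < s ->
  exists g, g * (h + imag s) = 1 /\ (h + imag s) * g = 1.
Proof.
move=> sh s0; pose t := cnorm h ^+ 2 / s.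
have t0 : 0 <= t by rewrite divr_ge0 ?sqr_ge0 // ltW.
have st : s * t = cnorm h ^+ 2 by rewrite mulrC divfK ?gt_eqF.
have st0 : 0 < s + t by rewrite ltr_wpDr.
have hit : cnorm (h - imag t) ^+ 2 <= cnorm h ^+ 2 + t ^+ 2.
  rewrite -cnorm_starM cstar_starB sh star_imag opprK imag_mulDB.
  apply: le_trans (cnormD _ _) _; rewrite expr2 lerD ?cnormM // cnormZr.
  by rewrite ger0_norm ?sqr_ge0 // ler_piMr ?sqr_ge0 // cnorm1_le1.
pose k : R[i] := Complex 0 (- (s + t)^-1).
have k1 : k * Complex 0 (s + t) = 1.
  apply/eqP; rewrite eq_complex /=; apply/andP; split; apply/eqP; last by ring.
  by field; rewrite gt_eqF.
have x1 : cnorm (k *: (imag t - h)) < 1.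
  rewrite cnormZi normrN gtr0_norm ?invr_gt0 // cnormC.
  rewrite mulrC ltr_pdivrMr // mul1r.
  rewrite -(@ltr_pXn2r _ 2) ?nnegrE ?cnorm_ge0 ?(ltW st0) //.
  apply: le_lt_trans hit _; have ->
    : (s + t) ^+ 2 = s ^+ 2 + 2 * (s * t) + t ^+ 2 by ring.
  by rewrite st; have := sqr_ge0 (cnorm h); have := exprn_gt0 2 s0; lra.
have [y [yx xy]] := neumann_inverse x1.
have E : 1 - k *: (imag t - h) = k *: (h + imag s).
  have -> : (1 : A) = k *: imag (s + t) by rewrite scalerA k1 scale1r.
  by rewrite -scalerBr imagD opprB addrACA subrr addr0 (addrC h).
exists (k *: y); split.
  by rewrite cstar_scaleAl -cstar_scaleAr -E.
by rewrite cstar_scaleAr -cstar_scaleAl -E.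
Qed.

(* The bounds come from the Cayley transform [(h - i s) / (h + i s)], which has
   norm at most 1. *)
Lemma selfadjoint_resolvent h s : star h = h -> 0 < s ->
  exists r, let S := h * h + (s ^+ 2)%:C%C *: (1 : A) in
    [/\ r * S = 1 /\ S * r = 1, star r = r,
        forall x, x * h = h * x -> x * r = r * x,
        cnorm ((s ^+ 2)%:C%C *: r) <= 1 &
        cnorm (h * ((s ^+ 2)%:C%C *: r)) <= s].
Proof.
move=> sh s0; have [g [gh hg]] := selfadjoint_shift_inverse sh s0.
have sg1 : (h - imag s) * star g = 1.
  by rewrite -{1}sh -star_imag -starD -cstar_starM gh cstar_star1.
have sg2 : star g * (h - imag s) = 1.
  by rewrite -{1}sh -star_imag -starD -cstar_starM hg cstar_star1.
pose u := (h - imag s) * g.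
have u1 : cnorm u <= 1.
  have uu : star u * u = 1.
    rewrite /u cstar_starM cstar_starB sh star_imag opprK -mulrA (mulrA (h +
      _)).
    by rewrite imag_mulDB -imag_mulBD -mulrA hg mulr1.
  have := cnorm_starM u; rewrite uu => e; have := cnorm1_le1 A.
  by rewrite e; have := cnorm_ge0 u; nra.
(* The identities [1 - u = 2 i s g] and [1 + u = 2 h g] turn the bound on [u] into bounds on [g] and
   [h g]; the resolvent will be [g g^*]. *)
have uE : u = 1 - imag (s *+ 2) * g.
  by rewrite -hg mulr2n imagD !mulrDl /u mulrBl opprD addrA addrK.
have g1 : s * cnorm g <= 1.
  have : cnorm (imag (s *+ 2) * g) <= 2.
    have -> : imag (s *+ 2) * g = 1 - u by rewrite uE opprB addrC subrK.
    by apply: le_trans (cnormB _ _) _; have := cnorm1_le1 A; lra.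
  rewrite imagE cnormZi ger0_norm ?mulrn_wge0 ?(ltW s0) //; lra.
have hg1 : cnorm (h * g) <= 1.
  have e : h * g + h * g = 1 + u.
    by rewrite -hg /u mulrDl mulrBl addrACA subrr addr0.
  have : cnorm (h * g + h * g) <= 2.
    by rewrite e; apply: le_trans (cnormD _ _) _; have := cnorm1_le1 A; lra.
  have -> : h * g + h * g = 2%:C%C *: (h * g).
    by rewrite rmorphMn rmorph1 scaler_nat mulr2n.
  by rewrite cnormZr ger0_norm //; lra.
have r1 : g * star g * (h * h + (s ^+ 2)%:C%C *: (1 : A)) = 1.
  by rewrite -imag_mulBD mulrA -(mulrA g) sg2 mulr1.
have r2 : (h * h + (s ^+ 2)%:C%C *: (1 : A)) * (g * star g) = 1.
  by rewrite -imag_mulBD mulrA -(mulrA _ _ g) hg mulr1.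
have sgn := cnorm_star g; have gn := cnorm_ge0 g.
exists (g * star g); split=> //.
- by rewrite cstar_starM starK.
- move=> x xh; apply: comm_inverse r1 r2 _.
  by rewrite mulrDr mulrDl mulrA xh -mulrA xh mulrA cstar_scaleAl cstar_scaleAr
    mulr1 mul1r.
- rewrite cnormZr ger0_norm ?sqr_ge0 //.
  have := cnormM g (star g); rewrite sgn => le.
  apply: (@le_trans _ _ (s ^+ 2 * (cnorm g * cnorm g))).
    by rewrite ler_pM2l // exprn_gt0.
  have : 0 <= s * cnorm g by rewrite mulr_ge0 // ltW.
  nra.
- rewrite cstar_scaleAr cnormZr ger0_norm ?sqr_ge0 //.
  have := cnormM (h * g) (star g); rewrite -mulrA sgn => le.
  apply: (@le_trans _ _ (s ^+ 2 * (cnorm (h * g) * cnorm g))).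
    by rewrite ler_pM2l // exprn_gt0.
  apply: (@le_trans _ _ (s ^+ 2 * cnorm g));
    last by rewrite expr2 -mulrA ler_piMr // ltW.
  by rewrite ler_pM2l ?exprn_gt0 // ler_piMl.
Qed.

End Resolvent.

(** * Cohen factorization *)

Section CohenFactorization.
Variables (R : realType) (A : cstarAlgType R).
Implicit Types (x y z h : A) (s t : R).

Definition rscale t x : A := t%:C%C *: x.

Lemma rscaleDl s t x : rscale (s + t) x = rscale s x + rscale t x.
Proof. by rewrite /rscale rmorphD scalerDl. Qed.

Lemma rscaleDr t x y : rscale t (x + y) = rscale t x + rscale t y.
Proof. exact: scalerDr. Qed.

Lemma rscaleN t x : rscale t (- x) = - rscale t x.
Proof. exact: scalerN. Qed.

Lemma rscaleA s t x : rscale s (rscale t x) = rscale (s * t) x.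
Proof. by rewrite /rscale scalerA rmorphM. Qed.

Lemma rscale1 x : rscale 1 x = x.
Proof. exact: scale1r. Qed.

Lemma rscaleMl t x y : rscale t x * y = rscale t (x * y).
Proof. exact: cstar_scaleAl. Qed.

Lemma rscaleMr t x y : x * rscale t y = rscale t (x * y).
Proof. exact: cstar_scaleAr. Qed.

Lemma star_rscale t x : star (rscale t x) = rscale t (star x).
Proof. exact: star_scale_real. Qed.

Lemma cnorm_rscale t x : 0 <= t -> cnorm (rscale t x) = t * cnorm x.
Proof. by move=> t0; rewrite cnormZr ger0_norm. Qed.

(* With [S = h^2 + s^2] and [B = h^2 + (s/2)^2], take [w = B S^-1]. *)
Lemma selfadjoint_factor h s : star h = h -> 0 < s ->
  exists w w' f f' p,
    [/\ w * w' = 1 /\ w' * w = 1,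
        [/\ w = 1 - rscale (3 / 4) f, w' = 1 + rscale 3 f' & 1 - f = p * h],
        star w = w /\ star f' = f',
        forall x, x * h = h * x -> [/\ x * w = w * x,
          x * w' = w' * x & x * f' = f' * x] &
        [/\ cnorm f <= 1, cnorm (h * f) <= s, cnorm f' <= 1
          & cnorm (h * f') <= s / 2]].
Proof.
move=> sh s0; have s20 : 0 < s / 2 by rewrite divr_gt0.
have [r [[rS Sr] sr rc rn rhn]] := selfadjoint_resolvent sh s0.
have [q [[qB Bq] sq qc qn qhn]] := selfadjoint_resolvent sh s20.
rewrite -/(rscale _ _) in rS Sr rn rhn qB Bq qn qhn.
set S := h * h + rscale (s ^+ 2) 1 in rS Sr.
set B := h * h + rscale ((s / 2) ^+ 2) 1 in qB Bq.
have BS : B = S - rscale (3 / 4 * s ^+ 2) 1.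
  rewrite /B /S -addrA; congr (_ + _); apply/eqP;
    rewrite eq_sym subr_eq -rscaleDl.
  by apply/eqP; congr (rscale _ _); field.
have SB : S = B + rscale (3 / 4 * s ^+ 2) 1 by rewrite BS subrK.
have wE : 1 - rscale (3 / 4) (rscale (s ^+ 2) r) = B * r.
  by rewrite BS mulrBl Sr rscaleMl mul1r rscaleA.
have w'E : 1 + rscale 3 (rscale ((s / 2) ^+ 2) q) = S * q.
  by rewrite SB mulrDl Bq rscaleMl mul1r rscaleA; congr (_ + rscale _ _); field.
(* Here [r = S^-1] and [q = B^-1]. The formulas for [w] and [w'] come from
   [S - B = 3/4 s^2 = 3 (s/2)^2], and [1 - f = r h^2]. *)
exists (B * r), (S * q), (rscale (s ^+ 2) r), (rscale ((s / 2) ^+ 2) q),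
  (r * h).
split.
- split; first by rewrite -mulrA (mulrA r) rS mul1r Bq.
  by rewrite -mulrA (mulrA q) qB mul1r Sr.
- split=> //; apply/eqP; rewrite subr_eq -mulrA; apply/eqP.
  by rewrite -rS /S mulrDr rscaleMr mulr1.
- split; last by rewrite star_rscale sq.
  by rewrite -wE cstar_starB cstar_star1 !star_rscale sr.
- move=> x xh; split.
  + by rewrite -wE mulrBr mulrBl mulr1 mul1r !rscaleMr !rscaleMl rc.
  + by rewrite -w'E mulrDr mulrDl mulr1 mul1r !rscaleMr !rscaleMl qc.
  + by rewrite rscaleMr rscaleMl qc.
- by [].
Qed.

(** [V] is the product of the factors [w] used so far and [U] its inverse; the last condition puts
    [V] within [4^-n] of [A h]. *)
Definition cohen_state (h : A) n (u : A * A * A) :=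
  let: (V, U, q) := u in
  [/\ U * V = 1 /\ V * U = 1, star V = V, V * h = h * V
    & V = rscale (4 ^- n) 1 + q * h].

(* [V' = V w] and [U' = w' U] for the factors [w], [w'] of [selfadjoint_factor]
   at [s = 2 sg^2], with [sg] small compared to the norms of [U] and [q]. *)
Lemma cohen_step a n (u : A * A * A) (eps : R) : 0 < eps -> eps <= 1 ->
    cohen_state (star a * a) n u ->
  exists u' : A * A * A, [/\ cohen_state (star a * a) n.+1 u',
    cnorm (u'.1.1 - u.1.1) <= 4 ^- n + eps &
    cnorm (a * u'.1.2 * u'.1.2 - a * u.1.2 * u.1.2) <= eps].
Proof.
case: u => [[V U] q] e0 e1 [[UV VU] sV Vh VE] /=;
  set h := star a * a in Vh VE *.
have sh : star h = h by rewrite cstar_starM starK.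
have Un := cnorm_ge0 U; have qn := cnorm_ge0 q.
(* Chosen so that both [15 sg ||U||^2] and [2 sg^2 ||q||] are at most [eps] when [sg = eps / D]; the
   15 bounds the norm of [6 + 9 f']. *)
pose D := 1 + 15 * cnorm U ^+ 2 + 2 * cnorm q.
have U2 := sqr_ge0 (cnorm U).
have D1 : 1 <= D by rewrite /D; lra.
have D0 : 0 < D by lra.
pose sg := eps / D.
have sgD : sg * D = eps by rewrite divfK ?gt_eqF.
have sg0 : 0 < sg by rewrite divr_gt0.
have sg1 : sg <= 1 by rewrite ler_pdivrMr // mul1r (le_trans e1).
have p1 : 0 <= sg * cnorm q by rewrite mulr_ge0 // ltW.
have p2 : 0 <= sg * cnorm U ^+ 2 by rewrite mulr_ge0 // ltW.
have epsE : eps = sg + 15 * (sg * cnorm U ^+ 2) + 2 * (sg * cnorm q).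
  by rewrite -sgD /D; ring.
have sgU : 15 * sg * cnorm U ^+ 2 <= eps by rewrite epsE -mulrA; lra.
have sgq : 2 * sg ^+ 2 * cnorm q <= eps.
  have : sg * (sg * cnorm q) <= sg * cnorm q by rewrite ler_piMl.
  have -> : 2 * sg ^+ 2 * cnorm q = 2 * (sg * (sg * cnorm q)) by ring.
  by rewrite epsE; lra.
have s0 : 0 < 2 * sg ^+ 2 by rewrite mulr_gt0 // exprn_gt0.
have [w [w' [f [f' [p [[ww' w'w] [wE w'E fE] [sw sf'] comm [fn hfn f'n
  hf'n]]]]]]] :=
  selfadjoint_factor sh s0.
have Uh : U * h = h * U by apply/esym/(comm_inverse UV VU).
have [Uw Uw' Uf'] := comm U Uh.
have [Vw _ _] := comm V Vh.
have [hw _ _] := comm h erefl.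
exists (V * w, w' * U, rscale (1 / 4) q + rscale (3 / 4) (V * p)); split=> /=.
- split.
  + by rewrite mulrA -(mulrA w') UV mulr1 -mulrA (mulrA w) ww' mul1r.
  + by rewrite cstar_starM sw sV Vw.
  + by rewrite -mulrA -hw mulrA Vh mulrA.
  (* From [w = 1 - 3/4 f] and [1 - f = p h] one gets [V w = 1/4 V + 3/4 V p h], which divides the
     scalar part of [V] by 4. *)
  + have Vp : V * p * h = V - V * f by rewrite -mulrA -fE mulrBr mulr1.
    rewrite mulrDl !rscaleMl Vp wE mulrBr mulr1 rscaleMr rscaleDr rscaleN.
    have -> : rscale (1 / 4) (q * h) = rscale (1 / 4) V - rscale (4 ^- n.+1) 1.
      rewrite VE rscaleDr rscaleA addrAC.
      have -> : (1 / 4 : R) * 4 ^- n = 4 ^- n.+1 by rewrite exprS invfM div1r.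
      by rewrite subrr add0r.
    rewrite addrA (addrCA (rscale (4 ^- n.+1) 1)) subrr addr0 addrA -rscaleDl.
    have -> : (1 / 4 + 3 / 4 : R) = 1 by field.
    by rewrite rscale1.
- rewrite wE mulrBr mulr1 addrAC subrr add0r cnormN rscaleMr cnorm_rscale
    ?divr_ge0 //.
  have : cnorm (V * f) <= 4 ^- n * 1 + cnorm q * (2 * sg ^+ 2).
    rewrite VE mulrDl rscaleMl mul1r -mulrA.
    apply: le_trans (cnormD _ _) _; rewrite lerD //.
      by rewrite cnorm_rscale ?ler_pM2l ?invr_ge0 ?invr_gt0 ?exprn_ge0
        ?exprn_gt0.
    by apply: le_trans (cnormM _ _) _; rewrite ler_wpM2l.
  have := cnorm_ge0 (V * f); lra.
- have f'0 := cnorm_ge0 f'.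
  (* By the C*-identity [||a f'||^2 = ||f' h f'|| <= ||h f'|| <= s / 2], which is [sg^2] for
     [s = 2 sg^2]. *)
  have afn : cnorm (a * f') <= sg.
    rewrite -(@ler_pXn2r _ 2) ?nnegrE ?cnorm_ge0 ?(ltW sg0) //.
    rewrite -cnorm_starM cstar_starM sf' -mulrA (mulrA (star a)) -/h.
    apply: le_trans (cnormM _ _) _.
    have := cnorm_ge0 (h * f'); have : 0 <= sg ^+ 2 by rewrite sqr_ge0.
    nra.
  (* Since [w'] commutes with [U], the difference is [a (w'^2 - 1) U^2], and [w' = 1 + 3 f']. *)
  have -> : a * (w' * U) * (w' * U) - a * U * U =
      a * f' * (rscale 6 1 + rscale 9 f') * (U * U).
    have -> : a * (w' * U) * (w' * U) = a * (w' * w') * (U * U).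
      by rewrite !mulrA -(mulrA (a * w') U) Uw' !mulrA.
    rewrite -[a * U * U]mulrA -mulrBl; congr (_ * _).
    rewrite -{2}[a]mulr1 -mulrBr -mulrA; congr (_ * _).
    rewrite w'E mulrDl mul1r !mulrDr mulr1 !rscaleMr !rscaleMl mulr1 rscaleA.
    have -> : (6 : R) = 3 + 3 by ring.
    have -> : (9 : R) = 3 * 3 by ring.
    by rewrite (rscaleDl 3 3) -(addrA 1) (addrC 1) addrK addrA.
  have g15 : cnorm (rscale 6 1 + rscale 9 f') <= 15.
    apply: le_trans (cnormD _ _) _; rewrite !cnorm_rscale //.
    have := cnorm1_le1 A; lra.
  apply: le_trans (cnormM _ _) _; apply: le_trans sgU.
  rewrite expr2 ler_pM ?cnorm_ge0 ?cnormM //.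
  apply: le_trans (cnormM _ _) _; rewrite mulrC ler_pM ?cnorm_ge0 //.
Qed.

End CohenFactorization.

(** * Factorization [a = d v^2] and projections generating [A a] *)

Section PrincipalClosed.
Variables (R : realType) (A : cstarAlgType R).
Implicit Types (a v x y e : A) (t : R).

Definition in_lclosure a v := forall t, 0 < t -> exists x,
  cnorm (v - x * a) < t.

(** Iterate [cohen_step] with [eps = 2^-n]: then [V_n] and [a U_n^2] converge to [v] and [d], and
    [a = a U_n^2 V_n^2] passes to the limit. *)
Lemma cohen_factorization a :
  exists v d, [/\ star v = v, in_lclosure a v & a = d * (v * v)].
Proof.
set h := star a * a; pose T := (A * A * A)%type.
pose half n : R := 2^-1 ^+ n.
have h0 n : 0 < half n by rewrite exprn_gt0.
have h1 n : half n <= 1 by rewrite exprn_ile1 // invf_le1 // ler1n.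
(* The invariant is a premise, so a successor exists for every triple and choice yields a total
   function. *)
pose next n (u u' : T) := cohen_state h n u -> [/\ cohen_state h n.+1 u',
    cnorm (u'.1.1 - u.1.1) <= 4 ^- n + half n &
    cnorm (a * u'.1.2 * u'.1.2 - a * u.1.2 * u.1.2) <= half n].
have nextP n u : exists u', next n u u'.
  have [inv|ninv] := pselect (cohen_state h n u); last by exists u.
  by have [u' u'P] := cohen_step (h0 n) (h1 n) inv; exists u'.
pose G n u := sval (cid (nextP n u)).
have GP n u : next n u (G n u) := svalP (cid (nextP n u)).
pose w := fix w n : T := if n is m.+1 then G m (w m) else (1, 1, 0).
have winv n : cohen_state h n (w n).
  elim: n => [|n /GP[]] //=;
    rewrite /cohen_state cstar_star1 !mul1r mulr1 mul0r addr0.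
  by rewrite expr0 invr1 rscale1.
have wS n := GP n (w n) (winv n).
have q4 n : (4 : R) ^- n <= half n.
  rewrite /half exprVn lef_pV2 ?posrE ?exprn_gt0 //.
  by apply: lerXn2r; rewrite ?nnegrE // ler_nat.
have q0 : 0 <= 2^-1 :> R by rewrite invr_ge0.
have q1 : 2^-1 < 1 :> R by rewrite invf_lt1 // ltr1n.
pose V n := (w n).1.1; pose D n := a * (w n).1.2 * (w n).1.2.
have [v vV] : exists v, forall n, cnorm (v - V n) <= 2 / (1 - 2^-1) * 2^-1 ^+ n.
  apply: cvg_of_geometric => // n; have [_ le _] := wS n.
  by apply: le_trans le _; have := q4 n; rewrite /half; lra.
have [d dD] : exists d, forall n, cnorm (d - D n) <= 1 / (1 - 2^-1) * 2^-1 ^+ n.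
  by apply: cvg_of_geometric => // n; have [_ _ le] := wS n; rewrite mul1r.
have c4 : 2 / (1 - 2^-1) = 4 :> R by field.
have c2 : 1 / (1 - 2^-1) = 2 :> R by field.
rewrite c4 in vV; rewrite c2 in dD.
exists v, d; split.
- apply/eqP; rewrite -subr_eq0; apply/eqP;
    apply: (@geometric_eq0 _ _ 8 2^-1) => // n.
  have sV : star (V n) = V n by have := winv n; rewrite /V;
    case: (w n) => [[? ?] ?] [].
  have -> : star v - v = star (v - V n) - (v - V n).
    by rewrite cstar_starB sV opprB addrA subrK.
  apply: le_trans (cnormB _ _) _; rewrite cnorm_star; have := vV n; lra.
- move=> t t0; have [n nt] := geometric_lt 5 q0 q1 t0.
  (* [V_n - 4^-n = q a^* a] lies in [A a]. The 5 is 4 from [||v - V_n||] plus 1 from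
     [4^-n <= 2^-n]. *)
  exists ((w n).2 * star a); apply: le_lt_trans nt.
  have -> : v - (w n).2 * star a * a = (v - V n) + rscale (4 ^- n) 1.
    have := winv n; rewrite /V; case: (w n) => [[V' U'] q'] /= [_ _ _ ->].
    by rewrite -mulrA opprD addrA addrAC subrK.
  apply: le_trans (cnormD _ _) _; rewrite cnorm_rscale ?invr_ge0 ?exprn_ge0 //.
  have : 4 ^- n * cnorm (1 : A) <= 4 ^- n.
    by rewrite ler_piMr ?cnorm1_le1 // invr_ge0 exprn_ge0.
  have := q4 n; have := vV n; rewrite /half; lra.
- have DV n : D n * (V n * V n) = a.
    have := winv n; rewrite /D /V;
      case: (w n) => [[V' U'] q'] /= [[UV _] _ _ _].
    by rewrite mulrA -(mulrA _ U') UV mulr1 -mulrA UV mulr1.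
  pose K := cnorm v + 4.
  have VK n : cnorm (V n) <= K.
    rewrite -[V n](subrK v); apply: le_trans (cnormD _ _) _.
    rewrite cnormC /K addrC lerD2l; apply: le_trans (vV n) _.
    by have := h1 n; rewrite /half; lra.
  have K0 : 0 <= K by rewrite /K addr_ge0 ?cnorm_ge0.
  apply/esym/eqP; rewrite -subr_eq0; apply/eqP.
  apply: (@geometric_eq0 _ _ (2 * (K * K) + cnorm d * (8 * K)) 2^-1) => // n.
  (* As [D_n V_n^2 = a] exactly, the error splits into terms with a factor [d - D_n] or
     [v - V_n]. *)
  have -> : d * (v * v) - a =
      (d - D n) * (V n * V n) + d * ((v - V n) * v + V n * (v - V n)).
    rewrite mulrBl DV mulrBl mulrBr [X in _ = _ + d * X]addrA subrK mulrBr.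
    by rewrite [RHS]addrC addrA subrK.
  have vK : cnorm v <= K by rewrite /K lerDl.
  apply: le_trans (cnormD _ _) _; rewrite [leRHS]mulrDl; apply: lerD.
    apply: le_trans (cnormM _ _) _; rewrite [leRHS]mulrAC ler_pM ?cnorm_ge0 //.
    by apply: le_trans (cnormM _ _) _; rewrite ler_pM ?cnorm_ge0.
  apply: le_trans (cnormM _ _) _; rewrite -[leRHS]mulrA ler_wpM2l ?cnorm_ge0 //.
  apply: le_trans (cnormD _ _) _.
  have e1 : cnorm ((v - V n) * v) <= 4 * 2^-1 ^+ n * K.
    by apply: le_trans (cnormM _ _) _; rewrite ler_pM ?cnorm_ge0.
  have e2 : cnorm (V n * (v - V n)) <= K * (4 * 2^-1 ^+ n).
    by apply: le_trans (cnormM _ _) _; rewrite ler_pM ?cnorm_ge0.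
  apply: le_trans (lerD e1 e2) _; rewrite le_eqVlt; apply/orP; left; apply/eqP.
  ring.
Qed.

Lemma in_lclosure_trans a v x : in_lclosure a v -> in_lclosure v x ->
  in_lclosure a x.
Proof.
move=> av vx t t0; have t2 : 0 < t / 2 by rewrite divr_gt0.
have [y xy] := vx _ t2.
have y0 : 0 < cnorm y + 1 by rewrite ltr_wpDl ?cnorm_ge0.
have [z vz] := av (t / 2 / (cnorm y + 1)) (divr_gt0 t2 y0).
exists (y * z).
have -> : x - y * z * a = (x - y * v) + y * (v - z * a).
  by rewrite mulrBr addrA subrK mulrA.
apply: le_lt_trans (cnormD _ _) _.
have : cnorm (y * (v - z * a)) <= t / 2.
  apply: le_trans (cnormM _ _) _.
  move/ltW: vz; rewrite ler_pdivlMr // => vz.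
  apply: le_trans vz; rewrite mulrC ler_wpM2l ?cnorm_ge0 // lerDl //.
lra.
Qed.

Lemma in_lclosure_mul a v x : in_lclosure a v -> in_lclosure a (x * v).
Proof.
move/in_lclosure_trans; apply=> t t0; exists x.
by rewrite subrr cnorm0.
Qed.

(* An element of [A a] close to the unit [e] of [e A e] is invertible there. *)
Lemma lprincipal_proj_of_closure a e : star e = e -> e * e = e -> a * e = a ->
  in_lclosure a e -> lprincipal_proj a e.
Proof.
move=> se ee ae acl; have [x ex] := acl 1 ltr01.
have [y [yx _]] := neumann_inverse ex.
have eE : e = y * x * a.
  rewrite -[LHS]mul1r -yx -!mulrA; congr (_ * _).
  by rewrite mulrBl mul1r mulrBl ee -mulrA ae opprB addrC subrK.
split=> // z; rewrite lprincipalP; split=> [[b ->]|<-];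
  first by rewrite -mulrA ae.
by exists (z * (y * x)); rewrite {1}eE !mulrA.
Qed.

Lemma lprincipal_proj_of_square a v b : star v = v -> in_lclosure a v ->
    (exists c, a = c * v) -> v = b * (v * v) -> exists e, lprincipal_proj a e.
Proof.
move=> sv av [c acv] vE; have [e [se ee ve eE]] := projection_of_square sv vE.
exists e; apply: lprincipal_proj_of_closure => //; last by rewrite eE;
  apply: in_lclosure_mul.
by rewrite acv -mulrA ve.
Qed.

Lemma lprincipal_proj_of_closed a :
  closed [set x : A | (x : A^o) \in lprincipal a] -> exists e,
    lprincipal_proj a e.
Proof.
move=> acl; have [v [d [sv av aE]]] := cohen_factorization a.
have : (v : A^o) \in lprincipal a.
  apply: (closed_cnormP acl) => t /av[x xv].
  by exists (x * a) => //; apply/lprincipalP; exists x.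
move=> /lprincipalP[c vc].
apply: (@lprincipal_proj_of_square a v (c * d)) => //.
  by exists (d * v); rewrite -mulrA.
by rewrite {1}vc aE !mulrA.
Qed.

(** [A a] is the fixed set of the continuous map sending [x] to [x e]. *)
Lemma closed_of_lprincipal_proj a e : lprincipal_proj a e ->
  closed [set x : A | (x : A^o) \in lprincipal a].
Proof.
move=> [_ _ aeP] x /closure_cnormP xcl; apply/aeP/eqP; rewrite -subr_eq0.
apply/eqP/cnorm_eq0/eqP; rewrite eq_le cnorm_ge0 andbT.
apply/ler_addgt0Pr => t t0; rewrite add0r.
have e1 : 0 < cnorm e + 1 by rewrite ltr_wpDl ?cnorm_ge0.
have [y /aeP ye xy] := xcl _ (divr_gt0 t0 e1).
have -> : x * e - x = (x - y) * e - (x - y).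
  by rewrite mulrBl ye opprB addrA subrK.
apply: le_trans (cnormB _ _) _.
apply: (@le_trans _ _ (cnorm (x - y) * (cnorm e + 1))).
  by rewrite mulrDr mulr1 lerD2r cnormM.
by rewrite -ler_pdivlMr // ltW.
Qed.

Lemma lprincipal_proj_of_finite_length a n :
    bounded_chains (full_submod (quot_mod (lprincipal a))) n ->
  exists e, lprincipal_proj a e.
Proof.
move=> an.
pose next (v v' : A) := [/\ star v' = v', in_lclosure v v' &
  exists d, v = d * (v' * v')].
have nextP v : exists v', next v v'.
  by have [v' [d [sv vv' vE]]] := cohen_factorization v; exists v';
    split=> //; exists d.
pose G v := sval (cid (nextP v)).
have GP v : next v (G v) := svalP (cid (nextP v)).
pose w n := iter n G a.
have wS i : {subset lprincipal (w i) <= lprincipal (w i.+1)}.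
  move=> x /lprincipalP[b ->]; have [_ _ [d dE]] := GP (w i).
  by apply/lprincipalP; exists (b * d * w i.+1); rewrite {1}dE !mulrA.
have aw i : {subset lprincipal a <= lprincipal (w i)}.
  by elim: i => [//|i IH] x /IH/wS.
have [i wi] := quot_chain_stabilises an aw wS.
have [sw _ [d dE]] := GP (w i).
have acl j : in_lclosure a (w j).
  elim: j => [|j IH].
    by move=> t t0; exists 1; rewrite mul1r subrr cnorm0.
  by have [_ cl _] := GP (w j); apply: in_lclosure_trans IH cl.
(* Stabilisation gives [w_(i+1) = c w_i]; with [w_i = d w_(i+1)^2] the square criterion holds for
   [b = c d]. *)
have /lprincipalP[c cE] : (w i.+1 : A^o) \in lprincipal (w i).
  by apply: wi; apply/lprincipalP; exists 1; rewrite mul1r.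
apply: (@lprincipal_proj_of_square a (w i.+1) (c * d)) => //.
  by apply/lprincipalP/aw/lprincipalP; exists 1; rewrite mul1r.
by rewrite {1}cE {1}dE !mulrA.
Qed.

End PrincipalClosed.

(** * The implications between the four conditions *)

Section Corollary.
Variables (R : realType) (A : cstarAlgType R) (a : A).

Lemma weakp_fredholmP : weakp_fredholm R a <->
  exists n, bounded_chains (full_submod (quot_mod (lprincipal a))) n.
Proof. exact: submod_length_fin. Qed.

(** If [b a - 1] is in the socle, then modulo [A a] each [z] equals [- z (b a - 1)], the image of a
    socle element. *)
Lemma semisimple_of_semip_fredholm : semip_fredholm a ->
  semisimple (quot_mod (lprincipal a)).
Proof.
move=> [u]; rewrite -(to_quot_ringK u); set b := repr _.
move=> ba; have {ba} /to_quot_ringP : to_quot_ring (soc A) (b * a) =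
  to_quot_ring (soc A) 1.
  by rewrite -to_quot_ringM.
rewrite -[_ \in soc A]/((b * a - 1 : A^o) \in socle A^o) => s m.
have [z ->] := to_quot_mod_surj m.
have -> : to_quot_mod (lprincipal a) z =
    to_quot_mod (lprincipal a) (- (z : A) *: (b * a - 1 : A^o)).
  apply/to_quot_modE/lprincipalP; exists ((z : A) * b).
  by rewrite scaleNr opprK -[_ *: _]/((z : A) * (b * a - 1)) mulrBr mulr1 addrC
    subrK mulrA.
apply: socle_hom; last exact: rpredZ.
- exact: to_quot_modD.
- by move=> k x; rewrite scale_to_quot_mod.
Qed.

(** The quotient is cyclic, generated by the class of [1], which lies in its socle. *)
Lemma weakp_of_semisimple : semisimple (quot_mod (lprincipal a)) ->
  weakp_fredholm R a.
Proof.
move=> ss; apply/weakp_fredholmP.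
apply: (@bounded_chains_cyclic _ _ (to_quot_mod (lprincipal a) (1 : A^o))) =>
  // x.
have [z ->] := to_quot_mod_surj x; exists z.
by rewrite scale_to_quot_mod -[z *: _]/((z : A) * 1) mulr1.
Qed.

End Corollary.

Theorem corollary5p5 (R : realType) (A : cstarAlgType R) (a : A) :
  [<-> weakp_fredholm R a;
       semip_fredholm a;
       semisimple (quot_mod (lprincipal a));
       (rho_l R a < +oo)%E /\ closed [set x : A | x \in lprincipal a]].
Proof.
tfae.
- move=> wa; have [n an] := (weakp_fredholmP a).1 wa.
  have [e ae] := lprincipal_proj_of_finite_length an.
  have [_ ee aeP] := ae.
  have /lprincipalP[b eb] : (e : A^o) \in lprincipal a by apply/aeP.
  (* With [e = b a], the class of [b] is a left inverse because [1 - b a = 1 - e] lies in the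
     socle. *)
  exists (to_quot_ring (soc A) b).
  rewrite -[LHS]/(quot_ring_mul _ _) to_quot_ringM -eb;
    apply/esym/to_quot_ringP.
  by have := finite_length_compl ae an.
- exact: semisimple_of_semip_fredholm.
- move=> /weakp_of_semisimple wa; have [n an] := (weakp_fredholmP a).1 wa.
  have [e ae] := lprincipal_proj_of_finite_length an.
  split; last exact: closed_of_lprincipal_proj ae.
  by apply/submod_length_fin; exists n; exact (finite_length_rann ae an).
- move=> [/submod_length_fin[n rn] cl];
    have [e ae] := lprincipal_proj_of_closed cl.
  by apply/weakp_fredholmP; exists n; exact (finite_length_of_rann ae rn).
Qed.
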